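(* Let $f(n,K_5)$ denote the smallest number of colors in an edge coloring of the complete graph $K_n$ in which every copy of $K_5$ intersects at least one of the color classes in an odd number of edges. Then, as $n\to\infty$, \[ f(n,K_5)\le e^{O((\log n)^{2/3}\log\log n)}. \]
   Context: For a graph $H$, $f(n,H)$ is the minimum number $t$ such that there is an edge coloring of $K_n$ with $t$ colors in which no copy of $H$ has every color appearing an even number of times among its edges (equivalently, every copy of $H$ meets some color class in an odd number of edges). *)

(* Defs.v *)
From mathcomp Require Import all_boot.
Set Implicit Arguments.
Unset Strict Implicit.
Unset Printing Implicit Defensive.

Record sgraph := SGraph {
  vertex :> finType;
  adj : rel vertex;
  adj_sym : symmetric adj;
  adj_irr : irreflexive adj }.

Definition has_edge (H : sgraph) : bool := [exists x : H, exists y : H, adj x y].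

Definition complete (p : nat) : sgraph :=
  @SGraph 'I_p (fun x y => x != y)
    (fun x y => congr1 negb (eq_sym x y)) (fun x => negbF (eqxx x)).

Lemma complete_has_edge (p : nat) : has_edge (complete p.+2).
Proof. by apply/existsP; exists ord0; apply/existsP; exists ord_max. Qed.

(* The edges of K_n on the vertex set 'I_n. *)
Definition edge (n : nat) : finType := {e : {set 'I_n} | #|e| == 2}.

(* The edges of the copy of H in K_n embedded by phi (phi injective). *)
Definition copy_edges (n : nat) (H : sgraph) (phi : {ffun H -> 'I_n}) :
    {set edge n} :=
  [set e : edge n |
    [exists x, exists y, adj x y && (val e == [set phi x; phi y])]].

Definition odd_coloring (n t : nat) (H : sgraph)
    (c : {ffun edge n -> 'I_t}) : bool :=
  [forall phi : {ffun H -> 'I_n}, injectiveb phi ==>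
    [exists i : 'I_t, odd #|[set e in copy_edges phi | c e == i]|]].

(* The rainbow coloring works as soon as H has an edge; for edgeless H no
   coloring works when n >= #|H|, so the minimum below does not exist. *)
Lemma odd_coloring_ex (n : nat) (H : sgraph) : has_edge H ->
  exists t, [exists c : {ffun edge n -> 'I_t}, odd_coloring H c].
Proof.
move=> /existsP[x /existsP[y xy]]; exists #|edge n|.
apply/existsP; exists [ffun e => enum_rank e].
apply/forallP => phi; apply/implyP => /injectiveP phi_inj.
have e2 : #|[set phi x; phi y]| == 2.
  rewrite cards2; case: (phi x =P phi y) => // /phi_inj exy.
  by move: xy; rewrite exy adj_irr.
pose e0 : edge n := exist (fun e : {set _} => #|e| == 2) _ e2.
apply/existsP; exists (enum_rank e0).
suff -> : [set e in copy_edges phi | [ffun e => enum_rank e] e == enum_rank e0]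
  = [set e0] by rewrite cards1.
apply/setP => e; rewrite !inE ffunE (inj_eq enum_rank_inj).
case: eqP => [->|]; last by rewrite andbF.
by rewrite andbT; apply/existsP; exists x; apply/existsP; exists y; rewrite xy /=.
Qed.

(* f(n,H) *)
Definition odd_coloring_number (n : nat) (H : sgraph) (hH : has_edge H) : nat :=
  ex_minn (odd_coloring_ex n hH).
Arguments odd_coloring_number n H hH : clear implicits.

(* Main.v *)
Require Import Defs.
From mathcomp Require Import all_boot all_order all_algebra.
From mathcomp Require Import all_classical all_reals all_analysis.
From mathcomp Require Import zify lra.
Import numFieldNormedType.Exports Order.TTheory GRing.Theory Num.Theory.
Set Implicit Arguments.
Unset Strict Implicit.
Unset Printing Implicit Defensive.

(** Identify the vertices with words of length d over m ordered digits, and color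
    a pair of words u < v (lexicographically) by the first index i where they
    differ, by the digits u_i, v_i, and by the sign of v_j - u_j for every j; call
    (i, u_i, v_i) the type of the color. Suppose that every color appears an even
    number of times on a K_5, and let j be the largest first-difference index of
    its pairs. Parity forces the vertices to be a, b, c, e, f where ab and ce have
    the same type (j, x, y), and where ab, ce and f have distinct prefixes below
    j. The four edges between ab and ce have the same type, and their signs at j
    are 0, 0, + and -. Hence the edges from f to one of the pairs, say ce, have
    this type too, and signs + and - at j, so that x < f_j < y. But then the edges
    from f to a and b have opposite nonzero signs at j and no other edge has their
    type, a contradiction.

    The number of colors is at most d m^2 4^d + 1. The choice d = k, m = 4^k is
    possible as soon as k^2 >= ln n, and gives at most 128^k colors; this would
    even yield exp(O(sqrt(ln n))), while k ~ (ln n)^(2/3) is enough here. *)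

(** * Words, first differences and the color of a pair of words *)

Section WordColoring.
Variables d m : nat.
Notation word := {ffun 'I_d -> 'I_m}.
Implicit Types (u v w : word) (i j k : 'I_d).

Definition agree j u v := [forall k : 'I_d, (k < j) ==> (u k == v k)].

Definition splits i u v := agree i u v && (u i != v i).

(* The first index where the two words differ, the two digits there, and for
   every index j whether the two j-th digits increase or decrease, the words
   being listed in lexicographic order. *)
Definition color : finType :=
  ('I_d * ('I_m * 'I_m) * {ffun 'I_d -> bool * bool})%type.

Definition ordered_color i u v : color :=
  (i, (u i, v i), [ffun j => (u j < v j, v j < u j)]).

(** The picked index is unique by [splits_uniq], and [None] arises only for equal words, by
    [splits_exists]. *)
Definition word_color u v : option color :=
  if [pick i | splits i u v] is Some i then
    Some (if u i < v i then ordered_color i u v else ordered_color i v u)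
  else None.

Lemma agreeP j u v :
  reflect (forall k, k < j -> u k = v k) (agree j u v).
Proof.
by apply: (iffP 'forall_implyP) => uv k kj; apply/eqP; [apply: uv | rewrite uv].
Qed.

Lemma agree_sym j : symmetric (agree j).
Proof. by move=> u v; apply: eq_forallb => k; rewrite eq_sym. Qed.

Lemma agree_trans j : transitive (agree j).
Proof.
by move=> v u w /agreeP uv /agreeP vw; apply/agreeP => k kj; rewrite uv // vw.
Qed.

Lemma agree_le i j u v : i <= j -> agree j u v -> agree i u v.
Proof.
by move=> ij /agreeP uv; apply/agreeP => k ki; apply: uv; apply: leq_trans ij.
Qed.

Lemma splits_sym i : symmetric (splits i).
Proof. by move=> u v; rewrite /splits agree_sym eq_sym. Qed.

Lemma splits_uniq i j u v : splits i u v -> splits j u v -> i = j.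
Proof.
move=> /andP[/agreeP ui /eqP ni] /andP[/agreeP uj /eqP nj];
  apply: val_inj => /=.
by case: (ltngtP i j) => [/uj|/ui|].
Qed.

Lemma splits_exists u v : u != v -> exists i, splits i u v.
Proof.
move=> uv; have [i0 ni0] : exists i, u i != v i.
  by apply/existsP; rewrite -negb_forall; apply: contra uv => /forallP e;
     apply/eqP/ffunP => i; apply/eqP.
case: (@arg_minnP _ i0 (fun i => u i != v i) (@nat_of_ord d) ni0) => i ni imin.
exists i; rewrite /splits ni andbT; apply/agreeP => k ki; apply/eqP.
by apply: contraLR ki => /imin; rewrite leqNgt.
Qed.

Lemma not_agree_splits j u v : ~~ agree j u v ->
  exists2 i : 'I_d, i < j & splits i u v.
Proof.
move=> nuv; have [|i si] := @splits_exists u v.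
  by apply: contra nuv => /eqP->; apply/agreeP.
exists i => //; rewrite ltnNge; apply: contra nuv => ji.
by case/andP: si => + _; apply: agree_le.
Qed.

(** Carries a first difference below [j] from one pair of representatives to all pairs between two
    prefix classes. *)
Lemma splits_congl i j u u' v : i < j -> agree j u u' ->
  splits i u v -> splits i u' v.
Proof.
move=> ij uu' /andP[uv nuv]; rewrite /splits -(agreeP _ _ _ uu') // nuv andbT.
by apply: agree_trans uv; rewrite agree_sym; apply: agree_le uu'; apply: ltnW.
Qed.

Lemma splits_congr i j u v v' : i < j -> agree j v v' ->
  splits i u v -> splits i u v'.
Proof. by rewrite ![splits i u _]splits_sym; apply: splits_congl. Qed.

Lemma word_color_sym u v : word_color u v = word_color v u.
Proof.
rewrite /word_color (@eq_pick _ _ (fun i => splits i v u)); last first.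
  by move=> i; rewrite /= splits_sym.
case: pickP => // i /andP[_ ni]; congr Some.
by case: ltngtP ni => // /val_inj->; rewrite eqxx.
Qed.

Lemma word_colorE i u v : splits i u v -> u i < v i ->
  word_color u v = Some (ordered_color i u v).
Proof.
move=> si lt_i; rewrite /word_color; case: pickP => [k sk|/(_ i)];
  last by rewrite si.
by rewrite (splits_uniq sk si) lt_i.
Qed.

Lemma word_colorEr i u v : splits i u v -> v i < u i ->
  word_color u v = Some (ordered_color i v u).
Proof. by rewrite splits_sym word_color_sym; apply: word_colorE. Qed.

(** * No five distinct words span an even K_5 *)

(** Evenness on each color class passes to unions of classes. Allowing any predicate [Q] makes it
    possible to test all colors of one type, or all those with a given sign at [j], at once. *)
Definition even_K5 (a b c e f : word) := forall Q : pred (option color),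
  ~~ (Q (word_color a b) (+) Q (word_color a c) (+) Q (word_color a e)
  (+) Q (word_color a f) (+) Q (word_color b c) (+) Q (word_color b e)
  (+) Q (word_color b f) (+) Q (word_color c e) (+) Q (word_color c f)
  (+) Q (word_color e f)).

Definition has_type (T : 'I_d * ('I_m * 'I_m)) : pred (option color) :=
  fun x => if x is Some (T', _) then T' == T else false.

Definition has_type_bit (T : 'I_d * ('I_m * 'I_m)) (b : bool) (j : 'I_d) :
    pred (option color) :=
  fun x => if x is Some (T', s) then
    (T' == T) && (if b then (s j).1 else (s j).2) else false.

(** Listing the two words in the opposite order exchanges the signs + ([b = true]) and -, whence the
    comparison of [u i < v i] with [b]. *)
Lemma has_type_bitE i u v T b j : splits i u v ->
  has_type_bit T b j (word_color u v) =
  (((i, if u i < v i then (u i, v i) else (v i, u i)) == T) &&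
   if (u i < v i) == b then u j < v j else v j < u j).
Proof.
move=> s; case: (ltngtP (u i) (v i)) => [lt|lt|/val_inj eq].
- by rewrite (word_colorE s lt) /= ffunE; case: b.
- by rewrite (word_colorEr s lt) /= ffunE; case: b.
- by case/andP: s; rewrite eq eqxx.
Qed.

Lemma has_typeE i u v T : splits i u v ->
  has_type T (word_color u v) =
  ((i, if u i < v i then (u i, v i) else (v i, u i)) == T).
Proof.
move=> s; case: (ltngtP (u i) (v i)) => [lt|lt|/val_inj eq].
- by rewrite (word_colorE s lt).
- by rewrite (word_colorEr s lt).
- by case/andP: s; rewrite eq eqxx.
Qed.

Lemma separated_pairs_not_even j (a b c e f : word) :
  splits j a b -> splits j c e -> a j < b j -> c j = a j -> e j = b j ->
  ~~ agree j a c -> ~~ agree j a f -> ~~ agree j c f -> ~ even_K5 a b c e f.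
Proof.
move=> sab sce lt cj ej /not_agree_splits[i ij sac]
  /not_agree_splits[k kj saf] /not_agree_splits[l lj scf] H.
have gt : (b j < a j) = false by rewrite ltnNge (ltnW lt).
have [gab _] := andP sab; have [gce _] := andP sce.
have sbc := splits_congl ij gab sac; have sae := splits_congr ij gce sac.
have sbe := splits_congl ij gab sae.
have sbf := splits_congl kj gab saf; have sef := splits_congl lj gce scf.
(* [T1] is the type of ac, ae, bc, be; [T2] that of af, bf; [T3] that of cf, ef. By [nj] below, ab
   and ce have none of these types. *)
pose T1 := (i, if a i < c i then (a i, c i) else (c i, a i)).
pose T2 := (k, if a k < f k then (a k, f k) else (f k, a k)).
pose T3 := (l, if c l < f l then (c l, f l) else (f l, c l)).
have Ebi : b i = a i by rewrite (agreeP _ _ _ gab).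
have Eei : e i = c i by rewrite (agreeP _ _ _ gce).
have Ebk : b k = a k by rewrite (agreeP _ _ _ gab).
have Eel : e l = c l by rewrite (agreeP _ _ _ gce).
have nj T : T = T1 \/ T = T2 \/ T = T3 -> forall x y, ((j, (x, y)) == T) = false.
  move=> hT x y; apply/eqP => E; have : T.1 = j by rewrite -E.
  by case: hT => [|[]] -> /= ej'; move: ij kj lj; rewrite -ej' ltnn.
(* For either sign [b0], exactly one of ae and bc has it at [j], while ac and be have sign 0. The
   four edges of type [T1] thus contribute the single term [T1 == T]. *)
have HT T b0 : T = T1 \/ T = T2 \/ T = T3 ->
  ~~ ((T1 == T) (+)
      ((T2 == T) && ((if (a k < f k) == b0 then a j < f j else f j < a j)
              (+) (if (a k < f k) == b0 then b j < f j else f j < b j))) (+)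
      ((T3 == T) && ((if (c l < f l) == b0 then a j < f j else f j < a j)
              (+) (if (c l < f l) == b0 then b j < f j else f j < b j)))).
  move=> hT; have := H (has_type_bit T b0 j).
  rewrite (has_type_bitE _ _ _ sab) (has_type_bitE _ _ _ sac).
  rewrite (has_type_bitE _ _ _ sae) (has_type_bitE _ _ _ saf).
  rewrite (has_type_bitE _ _ _ sbc) (has_type_bitE _ _ _ sbe).
  rewrite (has_type_bitE _ _ _ sbf) (has_type_bitE _ _ _ sce).
  rewrite (has_type_bitE _ _ _ scf) (has_type_bitE _ _ _ sef).
  rewrite Ebi Eei Ebk Eel cj ej -/T1 -/T2 -/T3.
  rewrite !lt !nj //= !ltnn !if_same gt /=.
  by case: (T1 == T); case: (T2 == T); case: (T3 == T);
     case: ((a i < c i) == b0); case: ((a k < f k) == b0);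
     case: ((c l < f l) == b0); case: (a j < f j); case: (b j < f j);
     case: (f j < a j); case: (f j < b j).
have H1t := HT T1 true (or_introl erefl).
have H1f := HT T1 false (or_introl erefl).
have H2t := HT T2 true (or_intror (or_introl erefl)).
have H2f := HT T2 false (or_intror (or_introl erefl)).
have H3t := HT T3 true (or_intror (or_intror erefl)).
have H3f := HT T3 false (or_intror (or_intror erefl)).
(* Otherwise a, c, f would have three pairwise distinct digits at one index, all taken from the two
   digits of one type. *)
have n123 : T1 = T2 -> T1 = T3 -> False.
  rewrite /T1 /T2 /T3 => -[E1 E2] [E3 E4].
  move: E2 E4; rewrite -E1 -E3.
  have /andP[_ /eqP nac] := sac.
  have /andP[_ /eqP naf] := saf; rewrite -E1 in naf.
  have /andP[_ /eqP ncf] := scf; rewrite -E3 in ncf.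
  by do 3 (case: ifP => _); congruence.
move: H1t H1f H2t H2f H3t H3f;
  rewrite !eqxx (eq_sym T2 T1) (eq_sym T3 T1) (eq_sym T3 T2).
move: lt n123.
(* If [T1] differs from [T2] and [T3], its own parity fails. If it equals one of them, parity for
   both signs forces [a j < f j < b j], and the remaining type then occurs exactly once with each
   sign. *)
case: (eqVneq T1 T2) => [->|_].
  case: (eqVneq T2 T3) => [<-|_]; first by move=> _ /(_ erefl erefl).
  move=> lt _ /=.
  case: (a k < f k); case: (c l < f l) => /=; case: (ltngtP (a j) (f j)) => //;
    case: (ltngtP (b j) (f j)) => //; lia.
case: (eqVneq T1 T3) => [->|_]; last by [].
move=> lt _ /=; case: (T2 == T3) => /=.
all: case: (a k < f k); case: (c l < f l) => /=;
  case: (ltngtP (a j) (f j)) => //; case: (ltngtP (b j) (f j)) => //; lia.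
Qed.

(** Quantifying over all orderings allows the five words to be relabeled freely. *)
Definition even_seq (s : seq word) := forall a b c e f,
  perm_eq s [:: a; b; c; e; f] -> even_K5 a b c e f.

Lemma has_typeP T u v : has_type T (word_color u v) ->
  splits T.1 u v /\ ((u T.1, v T.1) = T.2 \/ (v T.1, u T.1) = T.2).
Proof.
rewrite /word_color; case: pickP => // i si /=.
by case: ifP => _ /= /eqP <-; split=> //; [left | right].
Qed.

Lemma not_agree_has_type j p u v : ~~ agree j u v ->
  has_type (j, p) (word_color u v) = false.
Proof.
by move=> nuv; apply/negP => /has_typeP[/= /andP[guv _] _]; rewrite guv in nuv.
Qed.

(** The type of af occurs exactly once: ab and ce lack the digit [f j], bf lacks the digit [a j],
    and the six edges from a, b, f to c, e split before [j]. *)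
Lemma agreeing_fifth_not_even j (a b c e f : word) :
  splits j a b -> splits j c e -> a j < b j -> c j = a j -> e j = b j ->
  f j != a j -> f j != b j -> ~~ agree j a c -> agree j a f ->
  ~ even_K5 a b c e f.
Proof.
move=> sab sce lt cj ej fa fb nac gaf H.
have [gab _] := andP sab; have [gce _] := andP sce.
have gfb : agree j f b by apply: agree_trans gab; rewrite agree_sym.
have nall u v : u \in [:: a; b; f] -> v \in [:: c; e] -> ~~ agree j u v.
  move=> hu hv; apply: contra nac => guv.
  have gau : agree j a u.
    by move: hu; rewrite !inE => /or3P[] /eqP-> //; apply/agreeP.
  have gcv : agree j c v.
    by move: hv; rewrite !inE => /orP[] /eqP-> //; apply/agreeP.
  by apply: agree_trans gau _; apply: agree_trans guv _; rewrite agree_sym.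
have saf : splits j a f by rewrite /splits gaf eq_sym.
have sbf : splits j b f by rewrite splits_sym /splits gfb.
have := H (has_type (j, if a j < f j then (a j, f j) else (f j, a j))).
rewrite (has_typeE _ sab) (has_typeE _ saf) (has_typeE _ sbf) (has_typeE _ sce).
rewrite (word_color_sym c f) (word_color_sym e f).
rewrite !not_agree_has_type ?nall ?inE ?eqxx ?orbT //.
rewrite cj ej lt ?eqxx !xpair_eqE ?eqxx /=.
have /andP[_ /negPf ab] := sab.
move/negPf: fa => fa; move/negPf: fb => fb.
by case: (a j < f j); case: (b j < f j); rewrite /= !xpair_eqE ?eqxx
  ?ab ?(eq_sym (b j) (a j)) ?ab ?fa ?fb ?(eq_sym (a j) (f j))
  ?(eq_sym (b j) (f j)) ?fa ?fb ?andbF.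
Qed.

Lemma maximal_split_not_even j (s : seq word) (a b c e f : word) :
  uniq s -> perm_eq s [:: a; b; c; e; f] ->
  splits j a b -> a j < b j ->
  {in s &, forall u v i, splits i u v -> i <= j} -> ~ even_seq s.
Proof.
move=> us ps sab lt jmax H.
have ms := perm_mem ps.
have [as_ bs cs es fs] : [/\ a \in s, b \in s, c \in s, e \in s & f \in s].
  by rewrite !ms !inE !eqxx ?orbT.
have un : uniq [:: a; b; c; e; f] by rewrite -(perm_uniq ps).
(* Agreement at [j] too would put the first difference beyond [j], against maximality. *)
have deep u v : u \in s -> v \in s -> u != v -> agree j u v -> u j != v j.
  move=> us_ vs uv guv; apply/eqP => euv.
  have [i si] := splits_exists uv; have := jmax _ _ us_ vs _ si.
  rewrite leq_eqVlt => /orP[/eqP/val_inj ij|ij].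
    by case/andP: si; rewrite ij euv eqxx.
  by case/andP: si => _; rewrite (agreeP _ _ _ guv) ?eqxx.
have [gab nab] := andP sab.
move: (un); rewrite /= !inE !negb_or !andbT -!andbA.
move=> /and5P[ab ac ae af /and5P[bc be bf ce /andP[cf ef]]].
(* An edge from one of a, b to [x] with the type of ab would give [x] the prefix and the [j]-th
   digit of the other one, against [deep]. *)
have notype x : x \in s -> x != a -> x != b ->
    has_type (j, (a j, b j)) (word_color a x) = false /\
    has_type (j, (a j, b j)) (word_color b x) = false.
  move=> xs xa xb.
  have gbx : agree j a x -> agree j b x.
    by move=> gax; apply: agree_trans gax; rewrite agree_sym.
  split; apply/negP => /has_typeP[/= /andP[gx nx]] [] [].
  - by move=> E; have := deep _ _ xs bs xb; rewrite E eqxx agree_sym;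
    apply/implyP/gbx.
  - by move=> E E'; move: lt; rewrite -E' ltnn.
  - by move=> E; move: lt; rewrite -E ltnn.
  - move=> E; have := deep _ _ xs as_ xa; rewrite E eqxx agree_sym.
    by move=> /(_ _)/negP; case=> //; apply: agree_trans gx.
(* If [f'] shares the prefix of a pair, [agreeing_fifth_not_even] applies, with the pairs exchanged
   when that pair is [c'], [e']. Otherwise [separated_pairs_not_even] does. *)
have key c' e' f' : perm_eq s [:: a; b; c'; e'; f'] ->
    has_type (j, (a j, b j)) (word_color c' e') -> c' j = a j -> False.
  move=> ps' /has_typeP[/= sce ceE] cj.
  have ej : e' j = b j.
    by case: ceE => -[] // E1 E2; move: lt; rewrite -E2 cj ltnn.
  have ms' := perm_mem ps'.
  have [cs' es' fs'] : [/\ c' \in s, e' \in s & f' \in s].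
    by rewrite !ms' !inE !eqxx ?orbT.
  have: uniq [:: a; b; c'; e'; f'] by rewrite -(perm_uniq ps').
  rewrite /= !inE !negb_or !andbT -!andbA.
  move=> /and5P[_ ac' ae' af' /and5P[bc' be' bf' ce' /andP[cf' ef']]].
  have [gce _] := andP sce.
  have nac : ~~ agree j a c'.
    by apply/negP => /(deep _ _ as_ cs' ac'); rewrite cj eqxx.
  have ps'' : perm_eq s [:: c'; e'; a; b; f'].
    by apply: (perm_trans ps');
      exact/permEl/(perm_catCA [:: a; b] [:: c'; e'] [:: f']).
  have naf : ~~ agree j a f'.
    apply/negP => gaf.
    apply: (agreeing_fifth_not_even sab sce lt cj ej _ _ nac gaf);
      last exact: H.
      by rewrite eq_sym; apply: deep.
    by rewrite eq_sym; apply: deep => //; apply: agree_trans _ gaf;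
      rewrite agree_sym.
  have ncf : ~~ agree j c' f'.
    apply/negP => gcf.
    apply: (agreeing_fifth_not_even sce sab _ _ _ _ _ _ gcf);
      last exact: H ps''.
    - by rewrite cj ej.
    - by rewrite cj.
    - by rewrite ej.
    - by rewrite eq_sym; apply: deep.
    - by rewrite eq_sym; apply: deep => //; apply: agree_trans _ gcf;
      rewrite agree_sym.
    - by rewrite agree_sym.
  by apply: (separated_pairs_not_even sab sce lt cj ej nac naf ncf); apply: H.
have key2 c' e' f' : perm_eq s [:: a; b; c'; e'; f'] ->
    has_type (j, (a j, b j)) (word_color c' e') -> False.
  move=> ps' hce; have [_ /= [] [ea eb]] := has_typeP hce;
    first exact: (key c' e' f').
  rewrite word_color_sym in hce; apply: (key e' c' f') hce ea.
  by apply: (perm_trans ps'); rewrite !perm_cons;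
    exact/permEl/(perm_catCA [:: c'] [:: e'] [:: f']).
(* The edge ab has this type and the six edges from a, b to c, e, f do not, so parity gives the type
   to one of ce, cf, ef. *)
have := H _ _ _ _ _ ps (has_type (j, (a j, b j))).
have [-> ->] := notype c cs ltac:(by rewrite eq_sym) ltac:(by rewrite eq_sym).
have [-> ->] := notype e es ltac:(by rewrite eq_sym) ltac:(by rewrite eq_sym).
have [-> ->] := notype f fs ltac:(by rewrite eq_sym) ltac:(by rewrite eq_sym).
rewrite (has_typeE _ sab) lt eqxx /=.
case hce: (has_type _ (word_color c e)); first by case: (key2 _ _ _ ps hce).
case hcf: (has_type _ (word_color c f)).
  have psf : perm_eq s [:: a; b; c; f; e].
    by apply: (perm_trans ps); rewrite !perm_cons;
      exact/permEl/(perm_catC [:: e] [:: f]).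
  by case: (key2 _ _ _ psf hcf).
case hef: (has_type _ (word_color e f)) => //.
have psf : perm_eq s [:: a; b; e; f; c].
  by apply: (perm_trans ps); rewrite !perm_cons;
    exact/permEl/(perm_catC [:: c] [:: e; f]).
by case: (key2 _ _ _ psf hef).
Qed.

Lemma size5_not_even (s : seq word) : uniq s -> size s = 5 -> ~ even_seq s.
Proof.
move=> us s5.
pose P (j : 'I_d) := has (fun u => has (splits j u) s) s.
have [j0 Pj0] : exists j, P j.
  case: s us s5 @P => [|u [|v s]] //= /andP[];
    rewrite inE negb_or => /andP[uv _] _ _.
  have [i si] := splits_exists uv; exists i.
  by rewrite si !orbT.
case: (@arg_maxnP _ j0 P (@nat_of_ord d) Pj0) => j /hasP[u su /hasP[v sv suv]] jmax.
have {}jmax : {in s &, forall u v i, splits i u v -> i <= j}.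
  by move=> x y sx sy i sxy; apply: jmax; apply/hasP; exists x => //;
    apply/hasP; exists y.
wlog lt : u v su sv suv / u j < v j.
  move=> wl; case: (ltngtP (u j) (v j)) => [|vu|/val_inj uv]; first exact: wl.
    by apply: (wl v u) => //; rewrite splits_sym.
  by case/andP: suv; rewrite uv eqxx.
have ps := perm_to_rem su.
have vr : v \in rem u s.
  rewrite (mem_rem_uniq _ us) inE /= sv andbT; apply/eqP => vu.
  by rewrite vu ltnn in lt.
have pr := perm_to_rem vr.
have pt : perm_eq s (u :: v :: rem v (rem u s)).
  by apply: (perm_trans ps); rewrite perm_cons.
move: (perm_size pt); rewrite s5.
case: (rem v (rem u s)) pt => [|c [|e [|f [|]]]] //= pt _.
exact: (maximal_split_not_even us pt suv lt jmax).
Qed.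

End WordColoring.

(** * Edges of a complete copy as pairs of entries of a list *)

(** On a list of five entries this computes to the ten terms of [even_K5], in the same order. *)
Fixpoint pair_count (T : Type) (F : T -> T -> bool) (s : seq T) : nat :=
  if s is x :: s' then count (F x) s' + pair_count F s' else 0.

(** By induction: the pairs in [x :: s] that contain [x] are the injective image of [s] under [y] to
    [[set x; y]], and the others lie in [s]. *)
Lemma card_pairs_in (T : finType) (P : pred {set T}) (s : seq T) : uniq s ->
  #|[set A : {set T} | [&& #|A| == 2, A \subset s & P A]]| =
  pair_count (fun x y => P [set x; y]) s.
Proof.
elim: s => [_|x s IH /= /andP[xs us]].
  apply: eq_card0 => A; rewrite !inE; apply/and3P => -[/cards2P[x [y [_ ->]]]].
  by move/fintype.subsetP/(_ x); rewrite !inE eqxx => /(_ isT).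
rewrite -IH // -size_filter; set F := seq.filter _ s.
have uF : uniq F by apply: filter_uniq.
have -> : size F = #|[set [set x; y] | y in F]|.
  rewrite card_in_imset ?(card_uniqP uF) // => y z yF zF /setP/(_ y).
  rewrite !inE eqxx orbT => /esym/orP[] /eqP // yx.
  by move: yF; rewrite mem_filter yx (negPf xs) andbF.
rewrite -[LHS](cardsID [set A : {set T} | x \in A]); congr (_ + _);
  apply: eq_card => A.
  rewrite !inE; apply/andP/imsetP => [[/and3P[A2 As PA] xA]|[y]].
    have /cards2P[u [v [uv AE]]] := A2.
    have [y yx AE'] : exists2 y, y != x & A = [set x; y].
      move: xA; rewrite AE !inE => /orP[] /eqP ->.
        by exists v; rewrite 1?eq_sym.
      by exists u => //; rewrite finset.setUC.
    exists y => //; rewrite mem_filter -AE' PA /=.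
    by move/fintype.subsetP/(_ y): As;
      rewrite AE' !inE eqxx orbT (negPf yx) => /(_ isT).
  rewrite mem_filter => /andP[Py ys] ->.
  rewrite Py !inE eqxx cards2 andbT; split=> //; apply/andP; split.
    by case: (eqVneq x y) ys => [<-|//]; rewrite (negPf xs).
  by apply/fintype.subsetP => z; rewrite !inE => /orP[] /eqP->;
    rewrite ?eqxx ?ys ?orbT.
rewrite !inE andbC; apply/andP/and3P => [[/and3P[A2 As PA] xA]|[A2 As PA]].
  split=> //; apply/fintype.subsetP => z zA; move/fintype.subsetP/(_ z zA): As;
    rewrite inE.
  by case/orP => // /eqP zx; rewrite -zx zA in xA.
split; last by apply: contra xs => /(fintype.subsetP As).
by apply/and3P; split=> //; apply/fintype.subsetP => z /(fintype.subsetP As);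
  rewrite inE orbC => ->.
Qed.

Lemma copy_edges_complete n p (phi : {ffun complete p -> 'I_n}) (e : edge n) :
  (e \in copy_edges phi) = (val e \subset codom phi).
Proof.
rewrite inE; apply/existsP/idP => [[x /existsP[y /andP[_ /eqP->]]]|es].
  by apply/fintype.subsetP => z; rewrite !inE => /orP[] /eqP->; apply: codom_f.
have /cards2P[u [v [uv eE]]] := valP e.
have /codomP[x ux] : u \in codom phi by apply: (fintype.subsetP es);
  rewrite eE !inE eqxx.
have /codomP[y vy] : v \in codom phi by apply: (fintype.subsetP es);
  rewrite eE !inE eqxx orbT.
exists x; apply/existsP; exists y; rewrite eE ux vy eqxx andbT /=.
by apply: contra uv => /eqP xy; rewrite ux vy xy.
Qed.

(** * From words to an edge coloring of K_n *)

Section EdgeColoring.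
Variables (d m n : nat) (g : 'I_n -> {ffun 'I_d -> 'I_m}).
Hypothesis g_inj : injective g.

Definition pair_color (A : {set 'I_n}) : option (color d m) :=
  if [pick p : 'I_n * 'I_n | A == [set p.1; p.2]] is Some p
  then word_color (g p.1) (g p.2) else None.

Lemma pair_colorE u v : u != v ->
  pair_color [set u; v] = word_color (g u) (g v).
Proof.
move=> uv; rewrite /pair_color; case: pickP => [[x y] /= /eqP E|/(_ (u, v))];
  last first.
  by rewrite eqxx.
have xy : x != y.
  by apply/eqP => xy; move/(congr1 (fun A : {set 'I_n} => #|A|)): E;
    rewrite !cards2 uv xy eqxx.
have : x \in [set u; v] by rewrite E !inE eqxx.
have : y \in [set u; v] by rewrite E !inE eqxx orbT.
rewrite !inE => /orP[] /eqP yE /orP[] /eqP xE; move: xy; rewrite xE yE ?eqxx //.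
by rewrite word_color_sym.
Qed.

Definition edge_color : {ffun edge n -> 'I_#|{: option (color d m)}|} :=
  [ffun e => enum_rank (pair_color (val e))].

Lemma odd_edge_color : odd_coloring (complete 5) edge_color.
Proof.
apply/forallP => phi; apply/implyP => /injectiveP phi_inj.
apply: contraT; rewrite negb_exists => /forallP even_i.
have us : uniq (codom phi) by apply/injectiveP.
have evenQ (Q : pred (option (color d m))) r : perm_eq (codom phi) r ->
    ~~ odd (pair_count (fun x y => Q (pair_color [set x; y])) r).
  move=> pr; have ur : uniq r by rewrite -(perm_uniq pr).
  rewrite -(card_pairs_in (fun A => Q (pair_color A)) ur).
  have -> : #|[set A : {set 'I_n} | [&& #|A| == 2, A \subset r & Q (pair_color A)]]| =
     #|[set e in copy_edges phi | Q (pair_color (val e))]|.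
    rewrite -(card_imset _ (@val_inj _ _ (edge n))); apply: eq_card => A.
    rewrite inE -(eq_subset_r (perm_mem pr)).
    apply/and3P/imsetP => [[A2 As QA]|[e]].
      by exists (exist _ A A2) => //; rewrite inE copy_edges_complete /= As.
    by rewrite inE copy_edges_complete => /andP[es Qe] ->; split=> //;
      apply: (valP e).
  (* The edges satisfying [Q] are grouped by color; each group is a whole color class of the copy,
     hence even. *)
  rewrite -sum1_card (partition_big edge_color (fun i => Q (enum_val i))) /=;
    last first.
    by move=> e; rewrite inE ffunE enum_rankK => /andP[].
  elim/big_ind: _ => [//|x y|i Qi]; first by rewrite oddD => /negPf-> /negPf->.
  have := even_i i; rewrite sum1_card; congr (~~ odd _); apply: eq_card => e.
  rewrite !inE [RHS]unfold_in /= !inE.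
  case: (edge_color e =P i) => [E|_]; last by rewrite !andbF.
  by move: Qi; rewrite -E ffunE enum_rankK => ->; rewrite !andbT.
have sc : size [seq g x | x <- codom phi] = 5
  by rewrite size_map size_codom card_ord.
have ug : uniq [seq g x | x <- codom phi] by rewrite map_inj_uniq.
case: (size5_not_even ug sc) => a b c e f ps Q.
have pre w : w \in [:: a; b; c; e; f] -> exists x, w = g x.
  by rewrite -(perm_mem ps) => /mapP[x _ ->]; exists x.
have [x1 E1] := pre a ltac:(by rewrite !inE eqxx ?orbT).
have [x2 E2] := pre b ltac:(by rewrite !inE eqxx ?orbT).
have [x3 E3] := pre c ltac:(by rewrite !inE eqxx ?orbT).
have [x4 E4] := pre e ltac:(by rewrite !inE eqxx ?orbT).
have [x5 E5] := pre f ltac:(by rewrite !inE eqxx ?orbT).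
move: ps; rewrite E1 E2 E3 E4 E5.
move=> /(@perm_map_inj _ _ _ g_inj (codom phi) [:: x1; x2; x3; x4; x5]) pr.
have := evenQ Q _ pr; rewrite (perm_uniq pr) in us.
move: us; rewrite /= !inE !negb_or !andbT -!andbA.
move=> /and5P[n12 n13 n14 n15 /and5P[n23 n24 n25 n34 /andP[n35 n45]]].
by rewrite !pair_colorE // !oddD !oddb /= !addbF !addbA.
Qed.

End EdgeColoring.

Lemma odd_coloring_number_le n t (H : sgraph) hH (c : {ffun edge n -> 'I_t}) :
  odd_coloring H c -> odd_coloring_number n H hH <= t.
Proof.
move=> hc; rewrite /odd_coloring_number; case: ex_minnP => k _; apply.
by apply/existsP; exists c.
Qed.

(** The factor [4 ^ d] counts the pairs of booleans that encode the signs, and the successor counts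
    [None]. *)
Lemma odd_coloring_number_K5_le n d m : n <= m ^ d ->
  odd_coloring_number n (complete 5) (complete_has_edge 3)
    <= (d * (m * m) * 4 ^ d).+1.
Proof.
move=> nmd;
  have nw : n <= #|{ffun 'I_d -> 'I_m}| by rewrite card_ffun !card_ord.
have g_inj : injective (fun i : 'I_n => enum_val (widen_ord nw i)).
  by move=> i j /enum_val_inj/(congr1 val) /= /val_inj.
apply: leq_trans (odd_coloring_number_le _ (odd_edge_color g_inj)) _.
by rewrite card_option !card_prod card_ffun card_prod !card_ord card_bool.
Qed.

(** * Choice of parameters and asymptotics *)

Local Open Scope classical_set_scope.
Local Open Scope ring_scope.

(** Here 128 = 2 * 4^3, and k + 1 <= 2^k absorbs both the factor [k] and the successor. *)
Lemma color_count_le (k : nat) :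
  ((k * (4 ^ k * 4 ^ k) * 4 ^ k).+1 <= 128 ^ k)%N.
Proof.
have -> : (128 ^ k = 2 ^ k * (4 ^ k * 4 ^ k * 4 ^ k))%N.
  by rewrite -!expnMn.
rewrite -mulnA.
apply: (@leq_trans (k.+1 * (4 ^ k * 4 ^ k * 4 ^ k))).
  by rewrite mulSn -add1n leq_add2r !muln_gt0 expn_gt0.
by rewrite leq_mul2r ltn_expl // orbT.
Qed.

(** From exp(-1/2) >= 1 - 1/2, by squaring and inverting. *)
Lemma expR1_le4 (R : realType) : expR (1 : R) <= 4.
Proof.
rewrite [X in expR X](_ : _ = - (- 2^-1 + - 2^-1)); last by lra.
have h : 2^-1 <= expR (- 2^-1 : R).
  by apply: le_trans (expR_ge1Dx _); lra.
rewrite expRN expRD -[leRHS]invrK lef_pV2 ?posrE ?mulr_gt0 ?expR_gt0 //.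
  have -> : 4^-1 = 2^-1 * 2^-1 :> R by lra.
  by apply: ler_pM => //; lra.
Qed.

Lemma near_ln_ge (R : realType) (A : R) :
  \forall n \near \oo, A <= ln (n%:R : R).
Proof.
have : \forall n \near \oo, expR A <= n%:R :> R
  by move/cvgryPge: (@cvgr_idn R); apply.
apply: filterS => n h; rewrite -[leLHS]expRK ler_ln ?posrE ?expR_gt0 //.
by apply: lt_le_trans h; apply: expR_gt0.
Qed.

Theorem theorem1p1 (R : realType) :
  exists h : nat -> R,
    h =O_\oo (fun n : nat => (ln n%:R) `^ (2 / 3) * ln (ln n%:R) : R) /\
    \forall n \near \oo,
      (odd_coloring_number n (complete 5) (complete_has_edge 3))%:R <= expR (h n).
Proof.
(* 14 = 2 * 7: below, k <= 2x with x = (ln n)^(2/3), and 128^k <= exp(7k). *)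
exists (fun n => 14 * ((ln n%:R) `^ (2 / 3) * ln (ln n%:R))); split.
  apply/eqO_exP; exists 14 => //; apply: filterE => n.
  by rewrite normrM (@ger0_norm _ 14).
near=> n.
have eL : expR 1 <= ln (n%:R : R) by near: n; apply: near_ln_ge.
set L := ln n%:R in eL *.
have L1 : 1 <= L by have := expR_ge1Dx (1 : R); lra.
have LL1 : 1 <= ln L by rewrite -[leLHS]expRK ler_ln ?posrE ?expR_gt0 //; lra.
set x := L `^ (2 / 3).
have x1 : 1 <= x by rewrite /x -[leLHS](powRr0 L) ler_powR //; lra.
(* x * x is L to the power 4/3, and L >= 1. *)
have Lx : L <= x * x.
  rewrite -powRD; last by apply/implyP => _;
    rewrite gt_eqF ?(lt_le_trans ltr01).
  by apply: le1r_powR => //; lra.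
pose k := (Num.truncn x).+1.
have xk : x < k%:R by apply: truncnS_gt.
have kx : k%:R <= 2 * x.
  have := @truncn_le R x; rewrite /k -natr1; lra.
have n0 : 0 < n%:R :> R.
  rewrite ltr0n lt0n; apply: contraTneq L1 => n0.
  by rewrite /L n0 ln0 // -ltNge.
(* n = exp(L) <= exp(k * k) <= 4^(k * k). *)
have nk : (n <= (4 ^ k) ^ k)%N.
  rewrite -(ler_nat R) -[leLHS]lnK ?posrE // -/L.
  apply: (@le_trans _ _ (expR (k%:R * (k%:R * 1)))).
    by rewrite ler_expR mulr1; apply: (le_trans Lx); nra.
  rewrite !expRM_natl !natrX.
  by do 2 (apply: lerXn2r; rewrite ?nnegrE ?exprn_ge0 ?expR_ge0 //);
    apply: expR1_le4.
have := leq_trans (odd_coloring_number_K5_le nk) (color_count_le k);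
  rewrite -(ler_nat R) => /le_trans; apply.
apply: (@le_trans _ _ (expR (k%:R * (7%:R * 1)))).
  rewrite natrX !expRM_natl; apply: lerXn2r;
    rewrite ?nnegrE ?exprn_ge0 ?expR_ge0 //.
  (* 128 = 2^7 and 1 + 1 <= exp(1). *)
  rewrite (_ : 128%:R = (1 + 1) ^+ 7 :> R);
    last by rewrite -[1 + 1]/(2%:R) -natrX.
  by apply: lerXn2r; rewrite ?nnegrE ?expR_ge0 // expR_ge1Dx.
rewrite ler_expR; nra.
Unshelve. all: by end_near. Qed.
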